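(* Let $\mathcal{G}:(\mathbb{Z},\leq)\to\mathbf{Grp}$ be a persistence group, and let $\theta=\{\theta_t\}_{t\in\mathbb{Z}}$ be a persistent function such that for each $s$, $\theta_s(g^{-1})=\overline{\theta_s(g)}$ for all $g\in\mathcal{G}_s$. Then for any $s\leq t$, the $(s,t)$-persistent Laplacian operator $\mathcal{L}_{s,t}$ is self-adjoint with respect to the standard inner product $$\langle f,g\rangle=\sum_{x\in\mathcal{G}_t}f(x)\cdot\overline{g(x)},\qquad f,g\in\mathrm{Hom}(\mathcal{G}_t,\mathbb{C}).$$
   Context: A persistence group is a functor $\mathcal{G}:(\mathbb{Z},\leq)\to\mathbf{Grp}$ with finite groups $\mathcal{G}_t$ and structure homomorphisms $\phi_{s,t}:\mathcal{G}_s\to\mathcal{G}_t$. $\mathrm{Hom}(\mathcal{G}_t,\mathbb{C})$ denotes the vector space of all complex-valued functions on $\mathcal{G}_t$. A persistent function on $\mathcal{G}$ is a family $\theta_t\in\mathrm{Hom}(\mathcal{G}_t,\mathbb{C})$ with $\theta_s=\theta_t\circ\phi_{s,t}$ for all $s\leq t$. The $(s,t)$-persistent Laplacian $\mathcal{L}_{s,t}:\mathrm{Hom}(\mathcal{G}_t,\mathbb{C})\to\mathrm{Hom}(\mathcal{G}_t,\mathbb{C})$ associated with $\theta$ is $$\mathcal{L}_{s,t}(\eta)(g)=d_s\,\eta(g)-\sum_{h\in\mathcal{G}_s}\theta_s(h)\,\eta(\phi_{s,t}(h^{-1})g),\qquad d_s=\sum_{h\in\mathcal{G}_s}\theta_s(h),\quad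 g\in\mathcal{G}_t.$$ *)

(* Defs.v *)
From HB Require Import structures.
From mathcomp Require Import all_boot all_order all_algebra all_fingroup.
From mathcomp Require Import complex reals.

Set Implicit Arguments.
Unset Strict Implicit.
Unset Printing Implicit Defensive.

Import Order.TTheory GRing.Theory Num.Theory.

Local Open Scope ring_scope.
Local Open Scope complex_scope.

(* Functors from the poset (int, <=) to finite groups. As [s <= t] is a boolean
   proposition, [pg_map] does not depend on the proof it is given.
   [UMagmaMorphism] is the structure of maps preserving * and 1. *)
Record persistence_group := PersistenceGroup {
  pg_obj :> int -> finGroupType;
  pg_map : forall s t : int, s <= t -> UMagmaMorphism.type (pg_obj s) (pg_obj t);
  pg_map_id : forall (t : int) (x : pg_obj t), pg_map (lexx t) x = x;
  pg_map_comp : forall (r s t : int) (rs : r <= s) (st : s <= t) (x : pg_obj r),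
    pg_map (le_trans rs st) x = pg_map st (pg_map rs x)
}.
Arguments pg_map G {s t} st : rename.

(* The values are taken in [R[i]^o] rather than [R[i]] so that the scalars of
   the vector space structure are complex, not real. *)
Notation cfun_space R gT := {ffun gT -> R[i]^o}.

Record persistent_function (R : realType) (G : persistence_group) :=
  PersistentFunction {
    pfun :> forall t : int, cfun_space R (G t);
    pfun_compat : forall (s t : int) (st : s <= t) (g : G s),
      pfun s g = pfun t (pg_map G st g)
  }.

Section Laplacian.
Variables (R : realType) (G : persistence_group) (theta : persistent_function R G).

Definition pdegree (s : int) : R[i] := \sum_(h : G s) (theta s h : R[i]).

Definition laplacian (s t : int) (st : s <= t) (eta : cfun_space R (G t)) :
    cfun_space R (G t) :=
  [ffun g => (pdegree s * eta g
              - \sum_(h : G s) theta s h * eta (pg_map G st (h^-1) * g)%g : R[i])].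

Fact laplacian_is_linear (s t : int) (st : s <= t) : linear (laplacian st).
Proof.
move=> a u v; apply/ffunP=> g; rewrite !ffunE.
under eq_bigr do rewrite !ffunE mulrDr [a *: _]/(a * _) mulrCA.
rewrite big_split -mulr_sumr mulrDr [a *: u g]/(a * _) mulrCA.
by rewrite scalerBr opprD addrACA.
Qed.

HB.instance Definition _ (s t : int) (st : s <= t) :=
  GRing.isLinear.Build R[i] (cfun_space R (G t)) (cfun_space R (G t)) _
    (laplacian st) (laplacian_is_linear st).

End Laplacian.

Definition inner_product (R : realType) (gT : finGroupType)
    (f g : cfun_space R gT) : R[i] :=
  \sum_(x : gT) (f x : R[i]) * Num.conj (g x : R[i]).

Definition self_adjoint (K : nzRingType) (V : lmodType K) (form : V -> V -> K)
    (A : {linear V -> V}) : Prop :=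
  forall u v : V, form (A u) v = form u (A v).

(* Main.v *)
Require Import Defs.
From mathcomp Require Import all_boot all_order all_algebra all_fingroup.
From mathcomp Require Import complex reals.

Import GRing.Theory Num.Theory.

Local Open Scope ring_scope.
Local Open Scope complex_scope.

(** The Laplacian is [d_s - \sum_h theta_s(h) T_h], where [T_h] is left
    translation of functions by the inverse of the image of [h] in [G t].
    Translations permute an orthonormal basis, so [T_h] is unitary and its
    adjoint is [T_(h^-1)] (lemma [inner_product_translate]).  Taking adjoints
    thus replaces the coefficient [theta_s(h)] of [T_h] by the conjugate of
    [theta_s(h^-1)], which is [theta_s(h)] again by the symmetry of [theta];
    the same symmetry makes the scalar [d_s] real (lemma [conj_pdegree]). *)

(** Inversion permutes the summands, and on each of them it has the effect of
    complex conjugation. *)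
Lemma conj_pdegree (R : realType) (G : persistence_group)
    (theta : persistent_function R G) (s : int) :
  (forall g : G s, theta s (g^-1)%g = Num.conj (theta s g : R[i])) ->
  Num.conj (pdegree theta s) = pdegree theta s.
Proof.
move=> theta_conj; rewrite /pdegree rmorph_sum (reindex_inj invg_inj) /=.
by apply: eq_bigr => h _; rewrite theta_conj conjCK.
Qed.

(** Left translation by [a] is unitary, being a permutation of the points, so
    its adjoint is its inverse, the translation by [a^-1]. *)
Lemma inner_product_translate (R : realType) (gT : finGroupType) (a : gT)
    (f g : cfun_space R gT) :
  inner_product [ffun x => f (a * x)%g] g
    = inner_product f [ffun x => g (a^-1 * x)%g].
Proof.
rewrite /inner_product (reindex_inj (mulgI a^-1%g)) /=.
by apply: eq_bigr => x _; rewrite !ffunE mulKVg.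
Qed.

Theorem proposition3p2p8 (R : realType) (G : persistence_group)
    (theta : persistent_function R G)
    (theta_conj : forall (s : int) (g : G s),
       theta s (g^-1)%g = Num.conj (theta s g : R[i]))
    (s t : int) (st : s <= t) :
  self_adjoint (K := R[i]) (V := cfun_space R (G t))
    (@inner_product R (G t)) (laplacian theta st).
Proof.
move=> u v.
pose T (h : G s) (f : cfun_space R (G t)) : cfun_space R (G t) :=
  [ffun x => f (pg_map G st h^-1 * x)%g].
have expand_l : inner_product (laplacian theta st u) v
    = pdegree theta s * inner_product u v
      - \sum_h (theta s h : R[i]) * inner_product (T h u) v.
  rewrite /inner_product mulr_sumr.
  under [X in _ = _ - X]eq_bigr do rewrite mulr_sumr.
  rewrite exchange_big -sumrB; apply: eq_bigr => x _ /=.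
  rewrite ffunE mulrBl mulrA; congr (_ - _); rewrite mulr_suml.
  by apply: eq_bigr => h _; rewrite ffunE mulrA.
have expand_r : inner_product u (laplacian theta st v)
    = Num.conj (pdegree theta s) * inner_product u v
      - \sum_h Num.conj (theta s h : R[i]) * inner_product u (T h v).
  rewrite /inner_product mulr_sumr.
  under [X in _ = _ - X]eq_bigr do rewrite mulr_sumr.
  rewrite exchange_big -sumrB; apply: eq_bigr => x _ /=.
  rewrite ffunE rmorphB rmorphM mulrBr mulrCA.
  congr (_ - _); rewrite rmorph_sum mulr_sumr.
  by apply: eq_bigr => h _; rewrite ffunE rmorphM mulrCA.
rewrite expand_l expand_r (conj_pdegree _ _ _ _ (theta_conj s)); congr (_ - _).
(* The term of [h] on one side is the term of [h^-1] on the other. *)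
rewrite [RHS](reindex_inj invg_inj) /=; apply: eq_bigr => h _.
rewrite theta_conj conjCK (inner_product_translate R (G t)).
congr (_ * inner_product _ _).
by apply/ffunP => x; rewrite !ffunE !gmulfV.
Qed.
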